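(* Let $n\ge 1$ and let $(d_1,\dots,d_n)$ and $(c_1,\dots,c_n)$ be two vectors of positive real numbers, each in non-decreasing order. Then there exists a strictly positive real $2n\times 2n$ matrix $\gamma$ such that $(d_1,\dots,d_n)$ are the symplectic eigenvalues of $\gamma$ and $(c_1,\dots,c_n)$ are the symplectic main diagonal elements of $\gamma$ if and only if the following $n+1$ conditions hold: $$\sum_{j=1}^k c_j \;\ge\; \sum_{j=1}^k d_j,\qquad k=1,\dots,n,$$ $$c_n-\sum_{j=1}^{n-1}c_j \;\le\; d_n-\sum_{j=1}^{n-1}d_j .$$
   Context: A strictly positive real matrix means a real symmetric positive definite matrix. Let $\sigma=\bigoplus_{k=1}^n\begin{pmatrix}0&1\\-1&0\end{pmatrix}$ and $\mathrm{Sp}(2n,\mathbb{R})=\{S\in\mathbb{R}^{2n\times 2n}: S\sigma S^T=\sigma\}$. For every strictly positive real $2n\times 2n$ matrix $M$ there is $S\in\mathrm{Sp}(2n,\mathbb{R})$ with $SMS^T=\mathrm{diag}(d_1,d_1,\dots,d_n,d_n)$, $d_j>0$; the numbers $d_1,\dots,d_n$ (unique up to order) are the symplectic eigenvalues of $M$. Equivalently, they are the square roots of the eigenvalues of $-M\sigma M\sigma$, each (doubly occurring) eigenvalue being counted once. The symplectic main diagonal elements of $M$ are the numbers $(c_1,\dots,c_n)$, where $c_k$ is the symplectic eigenvalue of the $k$-th $2\times 2$ main diagonal block of $M$ (rows and columns $2k-1,2k$), i.e. $c_k=(M_{2k-1,2k-1}M_{2k,2k}-M_{2k-1,2k}^2)^{1/2}$.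 Empty sums are $0$. *)

(* Defs.v *)
(* MathComp world; the real numbers are an arbitrary R : realType. *)
From HB Require Import structures.
From mathcomp Require Import all_boot all_order all_algebra.
From mathcomp Require Import reals.

Set Implicit Arguments.
Unset Strict Implicit.
Unset Printing Implicit Defensive.

Import Order.TTheory GRing.Theory Num.Theory.
Local Open Scope ring_scope.

(* Real 2n x 2n matrices, with 2n written as a sum of n blocks of size 2 so
   that \mxdiag_(k < n) is the direct sum of n 2 x 2 matrices and
   submxblock M k k is the k-th 2 x 2 main diagonal block of M. *)
Notation modemx R n := 'M[R]_(\sum_(k < n) 2).

Definition strictly_positive (R : realType) (m : nat) (M : 'M[R]_m) : Prop :=
  M^T = M /\ forall x : 'rV[R]_m, x != 0 -> 0 < (x *m M *m x^T) 0 0.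

(* The 2 x 2 matrix with rows (0, 1) and (-1, 0). *)
Definition sigma1 (R : realType) : 'M[R]_2 :=
  delta_mx 0 1 - delta_mx 1 0.

Definition sigma (R : realType) (n : nat) : modemx R n :=
  \mxdiag_(k < n) sigma1 R.

Definition symplectic (R : realType) (n : nat) (S : modemx R n) : Prop :=
  S *m sigma R n *m S^T = sigma R n.

(* The symplectic eigenvalues of M are unique only up to order; the family d
   lists all of them, with multiplicity, in some order. *)
Definition symplectic_eigenvalues (R : realType) (n : nat)
    (M : modemx R n) (d : 'I_n -> R) : Prop :=
  (forall k, 0 < d k) /\
  exists2 S : modemx R n, symplectic S &
    S *m M *m S^T = \mxdiag_(k < n) (d k)%:M.

(* The 1-fold direct sum only casts the 2 x 2 block to the type of a
   one-mode matrix. *)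
Definition symplectic_main_diagonal (R : realType) (n : nat)
    (M : modemx R n) (c : 'I_n -> R) : Prop :=
  forall k : 'I_n,
    symplectic_eigenvalues (\mxdiag_(i < 1) submxblock M k k) (fun=> c k).

(* Main.v *)
(* Write gamma = T D T^T with T symplectic, D the direct sum of the d_k I and,
   after local symplectic transformations, diagonal blocks c_k I, so that
   2 c_k is the trace of the k-th block.

   Necessity. Abel summation reduces the partial sum inequalities to a lower
   bound 2 |P :&: Q| for the squared norm of the sub-block of T with rows in P
   and columns in Q, when P and Q cover all modes. For the last inequality one
   tests the rows of T D^(1/2) outside the last mode against sigma U, where U is
   a complex reflection: tr (D U) >= tr D - 4 d_n because U has a single complex
   eigenvalue -1, and U can be chosen so that the last mode contributes 2 c_n.

   Sufficiency. As in Horn's theorem, the c_k are produced one at a time by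
   transformations of two modes; such a transformation turns (x, y), x <= y,
   into (a, b) as soon as a + b >= x + y and |a - b| <= y - x. *)
Require Import Defs.
From HB Require Import structures.
From mathcomp Require Import all_boot all_order all_algebra.
From mathcomp Require Import reals.
From mathcomp Require Import ring lra zify.

Set Implicit Arguments.
Unset Strict Implicit.
Unset Printing Implicit Defensive.

Import Order.TTheory GRing.Theory Num.Theory.
Local Open Scope ring_scope.

(** * Transformations of two modes *)

(** By hypothesis [s + 2 * rho] and [s - 2 * rho] are nonnegative; their square roots serve as
    [q + r] and [q - r]. *)
Lemma prod_sum_sqr_ex (R : rcfType) (rho s : R) :
  2 * rho <= s -> - (2 * rho) <= s ->
  exists q r, q * r = rho /\ q ^+ 2 + r ^+ 2 = s.
Proof.
move=> h1 h2.
have hu : Num.sqrt (s + 2 * rho) ^+ 2 = s + 2 * rho by rewrite sqr_sqrtr //; lra.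
have hv : Num.sqrt (s - 2 * rho) ^+ 2 = s - 2 * rho by rewrite sqr_sqrtr //; lra.
set u := Num.sqrt (s + _) in hu; set v := Num.sqrt (s - _) in hv.
exists ((u + v) / 2), ((u - v) / 2).
split.
  have -> : (u + v) / 2 * ((u - v) / 2) = (u ^+ 2 - v ^+ 2) / 4 by field.
  by rewrite hu hv; field.
have -> : ((u + v) / 2) ^+ 2 + ((u - v) / 2) ^+ 2 = (u ^+ 2 + v ^+ 2) / 2 by field.
by rewrite hu hv; field.
Qed.

(* [q] and [r] parametrise the 2 x 2 matrix [[1, q], [r, 1]], up to a rescaling of
   its rows. The two equations only involve [rho = q r] and [q^2 + r^2]; their
   difference determines [rho], and [2 |rho| <= q^2 + r^2] is then equivalent to
   the hypotheses on [a] and [b]. *)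
Lemma two_mode_ratio (R : rcfType) (x y a b : R) :
  0 < x -> x <= y -> 0 < a -> a <= b -> x + y <= a + b -> b - a <= y - x ->
  exists q r, [/\ 0 < 1 - q * r,
    (x + q ^+ 2 * y) * (x + r ^+ 2 * y) = a ^+ 2 * (1 - q * r) ^+ 2 &
    (y + r ^+ 2 * x) * (y + q ^+ 2 * x) = b ^+ 2 * (1 - q * r) ^+ 2].
Proof.
move=> x0 xy a0 ab hs hd.
(* When [x = y], also [a = b], and the denominator [N + D] used below would vanish. The two
   equations then coincide, and it suffices to take [q = r] with [x * (1 + rho) = a * (1 - rho)]. *)
have [xy'|ne] := eqVneq x y.
  subst y; have ? : b = a by lra.
  subst b.
  set rho := (a - x) / (a + x).
  have r0 : 0 <= rho by apply: divr_ge0; lra.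
  have r1 : x * (1 + rho) = a * (1 - rho).
    rewrite /rho; field; lra.
  have [q [r [qr qqrr]]] := @prod_sum_sqr_ex R rho (2 * rho) (lexx _) ltac:(lra).
  have E : (x + q ^+ 2 * x) * (x + r ^+ 2 * x) = a ^+ 2 * (1 - q * r) ^+ 2.
    rewrite qr -exprMn -r1 -qr.
    have -> : (x + q ^+ 2 * x) * (x + r ^+ 2 * x) =
       x ^+ 2 * (1 + (q ^+ 2 + r ^+ 2) + (q * r) ^+ 2) by ring.
    by rewrite qqrr -qr; ring.
  exists q, r; split=> //; last by rewrite -E; ring.
  rewrite qr /rho.
  have -> : 1 - (a - x) / (a + x) = 2 * x / (a + x) by field; lra.
  by apply: divr_gt0; lra.
have {ne} xy' : x < y by rewrite lt_neqAle ne.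
set N := b ^+ 2 - a ^+ 2; set D := y ^+ 2 - x ^+ 2.
have D0 : 0 < D by rewrite /D; nra.
have N0 : 0 <= N by rewrite /N; nra.
have ND : 0 < N + D by lra.
(* Subtracting the equations gives [D * (1 - rho ^+ 2) = N * (1 - rho) ^+ 2], solved here after
   cancelling [1 - rho]. The first equation then dictates the value [s] of [q ^+ 2 + r ^+ 2]. *)
set rho := (N - D) / (N + D).
have e1 : 1 - rho = 2 * D / (N + D) by rewrite /rho; field; lra.
have p1 : 0 < 1 - rho by rewrite e1; apply: divr_gt0; lra.
have y0 : 0 < y by lra.
have xy0 : 0 < x * y by apply: mulr_gt0.
set s := (a ^+ 2 * (1 - rho) ^+ 2 - x ^+ 2 - rho ^+ 2 * y ^+ 2) / (x * y).
have hsE : s * (x * y) = a ^+ 2 * (1 - rho) ^+ 2 - x ^+ 2 - rho ^+ 2 * y ^+ 2.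
  by rewrite /s mulfVK // gt_eqF.
have key t : 0 <= t -> x + t * y <= a * (1 - rho) -> t ^+ 2 = rho ^+ 2 -> 2 * t <= s.
  move=> t0 ht t2.
  rewrite -(ler_pM2r xy0) hsE -t2.
  have : (x + t * y) ^+ 2 <= (a * (1 - rho)) ^+ 2.
    rewrite ler_sqr ?nnegrE //; first by apply: addr_ge0; [lra|apply: mulr_ge0; lra].
    by apply: mulr_ge0; lra.
  by rewrite exprMn; lra.
(* After clearing denominators this bound follows from [b <= a + (y - x)], and its companion [hm]
   from [x + y - a <= b]. *)
have hp : x + rho * y <= a * (1 - rho).
  rewrite -(ler_pM2r ND) e1.
  have -> : (x + rho * y) * (N + D) = x * (N + D) + y * (N - D).
    rewrite /rho; field; lra.
  have -> : a * (2 * D / (N + D)) * (N + D) = 2 * a * D by field; lra.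
  have h : b ^+ 2 <= (a + (y - x)) ^+ 2 by rewrite ler_sqr ?nnegrE; lra.
  have h' : 0 <= (y + x) * ((a + (y - x)) ^+ 2 - b ^+ 2).
    by apply: mulr_ge0; lra.
  by move: h'; rewrite /N /D; lra.
have hm : x - rho * y <= a * (1 - rho).
  rewrite -(ler_pM2r ND) e1.
  have -> : (x - rho * y) * (N + D) = x * (N + D) - y * (N - D).
    rewrite /rho; field; lra.
  have -> : a * (2 * D / (N + D)) * (N + D) = 2 * a * D by field; lra.
  have h : 0 <= (b - (x + y - a)) * (b + (x + y - a)) by apply: mulr_ge0; lra.
  have h' : 0 <= (y - x) * ((b - (x + y - a)) * (b + (x + y - a))).
    by apply: mulr_ge0; lra.
  by move: h'; rewrite /N /D; lra.
have s2 : 2 * `|rho| <= s.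
  apply: key; first exact: normr_ge0.
    by have [?|?] := ger0P rho; lra.
  by rewrite real_normK // num_real.
have [q [r [qr qqrr]]] : exists q r, q * r = rho /\ q ^+ 2 + r ^+ 2 = s.
  apply: prod_sum_sqr_ex; apply: le_trans s2; have := ler_norm rho.
    by lra.
  by have := ler_norm (- rho); rewrite normrN; lra.
exists q, r; rewrite qr; split=> //.
  have -> : (x + q ^+ 2 * y) * (x + r ^+ 2 * y) =
     x ^+ 2 + (q ^+ 2 + r ^+ 2) * (x * y) + (q * r) ^+ 2 * y ^+ 2 by ring.
  by rewrite qqrr hsE qr; ring.
have -> : (y + r ^+ 2 * x) * (y + q ^+ 2 * x) =
     y ^+ 2 + (q ^+ 2 + r ^+ 2) * (x * y) + (q * r) ^+ 2 * x ^+ 2 by ring.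
rewrite qqrr hsE qr.
have -> : b ^+ 2 = a ^+ 2 + N by rewrite /N; ring.
have -> : y ^+ 2 = x ^+ 2 + D by rewrite /D; ring.
by rewrite /rho; field; lra.
Qed.

(** The rows of the matrix [[[1, q], [r, 1]]] from [two_mode_ratio] are rescaled so that the
    unprimed forms take the values [a] and [b]. The primed entries are those of the inverse
    transpose, and the ratio equations give it the same values. *)
Lemma two_mode_sorted (R : rcfType) (x y a b : R) :
  0 < x -> x <= y -> 0 < a -> a <= b -> x + y <= a + b -> b - a <= y - x ->
  exists p q r s p' q' r' s' : R,
    [/\ p * p' + q * q' = 1 /\ p * r' + q * s' = 0,
        r * p' + s * q' = 0 /\ r * r' + s * s' = 1,
        p ^+ 2 * x + q ^+ 2 * y = a /\ p' ^+ 2 * x + q' ^+ 2 * y = a &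
        r ^+ 2 * x + s ^+ 2 * y = b /\ r' ^+ 2 * x + s' ^+ 2 * y = b].
Proof.
move=> x0 xy a0 ab hs hd.
have [q [r [d0 ea eb]]] := two_mode_ratio x0 xy a0 ab hs hd.
have y0 : 0 < y by lra.
set u := x + q ^+ 2 * y in ea; set u' := x + r ^+ 2 * y in ea.
set v := y + r ^+ 2 * x in eb; set v' := y + q ^+ 2 * x in eb.
have pos z t w : 0 < z -> 0 < t -> 0 < z + w ^+ 2 * t :> R.
  by move=> z0 t0; apply: ltr_pwDl => //; apply: mulr_ge0; rewrite ?sqr_ge0 ?ltW.
have u0 : 0 < u by apply: pos.
have v0 : 0 < v by apply: pos.
have la0 : 0 < a / u by apply: divr_gt0.
have mu0 : 0 < b / v by apply: divr_gt0; lra.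
have ela := sqr_sqrtr (ltW la0); have emu := sqr_sqrtr (ltW mu0).
have : 0 < Num.sqrt (a / u) by rewrite sqrtr_gt0.
have : 0 < Num.sqrt (b / v) by rewrite sqrtr_gt0.
move: ela emu; set l := Num.sqrt _; set m := Num.sqrt _ => ela emu m0 l0.
set e := 1 - q * r in d0 ea eb.
have ln : l != 0 by rewrite gt_eqF.
have mn : m != 0 by rewrite gt_eqF.
have en : e != 0 by rewrite gt_eqF.
exists l, (l * q), (m * r), m, (1 / (l * e)), (- r / (l * e)), (- q / (m * e)), (1 / (m * e)).
have un : u != 0 by rewrite gt_eqF.
have vn : v != 0 by rewrite gt_eqF.
have an : a != 0 by rewrite gt_eqF.
have bn : b != 0 by rewrite gt_eqF //; lra.
split; split; rewrite /e in en *; try by field; rewrite ?ln ?mn ?en.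
- rewrite exprMn ela -mulrA.
  transitivity (a / u * u); first by rewrite /u; ring.
  by rewrite mulfVK.
- transitivity (u' / (l ^+ 2 * e ^+ 2)); first by rewrite /u' /e; field; rewrite ln en.
  apply: (canLR (mulfK _)); first by rewrite mulf_neq0 // expf_neq0.
  apply: (mulfI un); rewrite ela ea.
  rewrite /e; field; exact: un.
- rewrite exprMn emu -mulrA.
  transitivity (b / v * v); first by rewrite /v; ring.
  by rewrite mulfVK.
transitivity (v' / (m ^+ 2 * e ^+ 2)); first by rewrite /v' /e; field; rewrite mn en.
apply: (canLR (mulfK _)); first by rewrite mulf_neq0 // expf_neq0.
apply: (mulfI vn); rewrite emu eb.
rewrite /e; field; exact: vn.
Qed.

Lemma two_mode (R : rcfType) (x y a b : R) :
  0 < x -> x <= y -> 0 < a -> 0 < b ->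
  x + y <= a + b -> b - a <= y - x -> a - b <= y - x ->
  exists p q r s p' q' r' s' : R,
    [/\ p * p' + q * q' = 1 /\ p * r' + q * s' = 0,
        r * p' + s * q' = 0 /\ r * r' + s * s' = 1,
        p ^+ 2 * x + q ^+ 2 * y = a /\ p' ^+ 2 * x + q' ^+ 2 * y = a &
        r ^+ 2 * x + s ^+ 2 * y = b /\ r' ^+ 2 * x + s' ^+ 2 * y = b].
Proof.
move=> x0 xy a0 b0 hs h1 h2; have [ab|/ltW ba] := lerP a b.
  exact: two_mode_sorted.
have [|p [q [r [s [p' [q' [r' [s' [[e1 e2] [e3 e4] ea eb]]]]]]]]] :=
  two_mode_sorted x0 xy b0 ba _ h2; first by lra.
by exists r, s, p, q, r', s', p', q'; split.
Qed.

(** * Reaching prescribed diagonal entries *)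

(* [G] acts on the positions and [H], its inverse transpose, on the momenta: the
   block-diagonal action of [G] and [H] is symplectic and turns the direct sum of
   the [d_k I] into a matrix whose diagonal blocks are the [c_k I]. *)
Definition realizable (R : rcfType) (d c : seq R) : Prop :=
  exists G H : nat -> nat -> R,
    (forall i j, (i < size c)%N -> (j < size c)%N ->
      \sum_(0 <= k < size c) G i k * H j k = (i == j)%:R) /\
    (forall i, (i < size c)%N ->
      \sum_(0 <= k < size c) G i k ^+ 2 * d`_k = c`_i /\
      \sum_(0 <= k < size c) H i k ^+ 2 * d`_k = c`_i).

Lemma realizable1 (R : rcfType) (a : R) : realizable [:: a] [:: a].
Proof.
exists (fun _ _ => 1), (fun _ _ => 1); split=> [[|i] [|j]|[|i]] //= _.
  by move=> _; rewrite big_nat1 mulr1.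
by rewrite !big_nat1 expr1n mul1r.
Qed.

(** The columns of [G] and [H] are permuted along with the entries of [d]. *)
Lemma realizable_perm (R : rcfType) (d1 d2 c : seq R) :
  perm_eq d1 d2 -> size d1 = size c -> realizable d1 c -> realizable d2 c.
Proof.
move=> p12 s1 [G [H [gh diag]]].
have /(perm_iotaP 0)[s ps d2E] : perm_eq d2 d1 by rewrite perm_sym.
have ss : size s = size c by rewrite (perm_size ps) size_iota.
have reindex (F : nat -> R) :
    \sum_(0 <= k < size c) F (nth 0%N s k) = \sum_(0 <= k < size c) F k.
  rewrite -{1}ss -(big_nth 0%N xpredT F) /=.
  by apply: perm_big; rewrite /index_iota subn0 -s1.
have d2k k : (k < size c)%N -> d2`_k = d1`_(nth 0%N s k).
  by move=> kc; rewrite {1}d2E (nth_map 0%N) // ss.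
exists (fun i k => G i (nth 0%N s k)), (fun i k => H i (nth 0%N s k)); split.
  by move=> i j ic jc; rewrite (reindex (fun k => G i k * H j k)) gh.
move=> i ic; have [gi hi] := diag i ic; split.
  rewrite -gi -(reindex (fun k => G i k ^+ 2 * d1`_k)).
  by apply: eq_big_nat => k /andP[_ kc]; rewrite d2k.
rewrite -hi -(reindex (fun k => H i k ^+ 2 * d1`_k)).
by apply: eq_big_nat => k /andP[_ kc]; rewrite d2k.
Qed.

(** A two-mode step followed by [G]: the direct sum of 1 and [G], times the direct sum of [[[p, q],
    [r, s]]] and an identity. *)
Definition extend_mode (R : rcfType) (p q r s : R) (G : nat -> nat -> R)
    (i k : nat) : R :=
  match i, k with
  | 0%N, 0%N => p
  | 0%N, 1%N => q
  | 0%N, _ => 0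
  | i'.+1, 0%N => G i' 0%N * r
  | i'.+1, 1%N => G i' 0%N * s
  | i'.+1, k'.+1 => G i' k'
  end.

(** The first two modes yield [a], which is final, and [z], which enters the realization of [c]. The
    rows after the first see [x] and [y] only through [z]. *)
Lemma realizable_cons (R : rcfType) (x y z a : R) (l c : seq R) :
  0 < x -> x <= y -> 0 < a -> 0 < z ->
  x + y <= a + z -> z - a <= y - x -> a - z <= y - x ->
  (0 < size c)%N ->
  realizable (z :: l) c -> realizable (x :: y :: l) (a :: c).
Proof.
move=> x0 xy a0 z0 h1 h2 h3 sc [G [H [gh diag]]].
have [p [q [r [s [p' [q' [r' [s' [[e1 e2] [e3 e4] [ga ha] [gz hz]]]]]]]]]] :=
  two_mode x0 xy a0 z0 h1 h2 h3.
move: sc gh diag; case sc: (size c) => [|n] // _ gh diag.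
exists (extend_mode p q r s G), (extend_mode p' q' r' s' H) => /=; rewrite sc.
split.
  move=> i j; rewrite big_nat_recl // big_nat_recl //=.
  case: i => [|i]; case: j => [|j] //=; rewrite ?ltnS => hi hj.
  - by rewrite big1 ?addr0 ?e1 // => k _; rewrite mul0r.
  - rewrite big1 ?addr0 => [|k _]; last by rewrite mul0r.
    by rewrite !(mulrCA _ (H j 0%N)) -mulrDr e2 mulr0.
  - rewrite big1 ?addr0 => [|k _]; last by rewrite mulr0.
    by rewrite -!mulrA -mulrDr e3 mulr0.
  rewrite eqSS -(gh i j hi hj) [RHS]big_nat_recl // addrA; congr (_ + _).
  by rewrite -[RHS]mulr1 -e4; ring.
have row0 (u v : R) K : \sum_(0 <= k < n.+2) extend_mode u v r s K 0 k ^+ 2 * (x :: y :: l)`_k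
     = u ^+ 2 * x + v ^+ 2 * y.
  rewrite big_nat_recl // big_nat_recl //= big1 ?addr0 // => k _.
  by rewrite expr0n mul0r.
have rowS (u v u' v' : R) K i : u' ^+ 2 * x + v' ^+ 2 * y = z ->
  \sum_(0 <= k < n.+2) extend_mode u v u' v' K i.+1 k ^+ 2 * (x :: y :: l)`_k
     = \sum_(0 <= k < n.+1) K i k ^+ 2 * (z :: l)`_k.
  move=> ez; rewrite big_nat_recl // big_nat_recl // [RHS]big_nat_recl //= addrA.
  by congr (_ + _); rewrite -ez; ring.
case=> [_|i]; first by split; rewrite row0.
by rewrite ltnS => hi; have [gi hi'] := diag i hi; rewrite !rowS.
Qed.

Lemma split_crossing (R : realDomainType) (a x : R) (s : seq R) :
  x <= a ->
  (exists l1 u v l2, x :: s = l1 ++ u :: v :: l2 /\ u <= a <= v) \/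
  all (<= a) (x :: s).
Proof.
elim: s x => [|y s IHs] x xa; first by right; rewrite /= xa.
have [ya|/ltW ay] := lerP y a; last first.
  by left; exists [::], x, y, s; rewrite xa ay.
have [[l1 [u [v [l2 [-> uav]]]]]|ays] := IHs y ya; last by right; rewrite /= xa.
by left; exists (x :: l1), u, v, l2.
Qed.

Lemma sum_le_sum_of_le (R : realDomainType) (a : R) (s t : seq R) :
  size s = size t -> all (<= a) s -> all (>= a) t ->
  \sum_(x <- s) x <= \sum_(x <- t) x.
Proof.
elim: s t => [|x s IHs] [|y t] //= [st] /andP[xa sa] /andP[ay ta].
by rewrite !big_cons lerD ?IHs // (le_trans xa).
Qed.

Lemma pairwise_le_replace (R : realDomainType) (x y z : R) (l1 l2 : seq R) :
  x <= z <= y -> pairwise <=%R (l1 ++ x :: y :: l2) ->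
  pairwise <=%R (l1 ++ z :: l2).
Proof.
move=> /andP[xz zy].
rewrite !pairwise_cat !allrel_consr /=.
move=> /and3P[/and3P[l1x l1y l12] pl1 /and3P[_ yl2 pl2]].
rewrite l12 pl1 pl2 !andbT; apply/andP; split.
  by apply: sub_all l1x => u /le_trans; apply.
by apply: sub_all yl2 => u; apply: le_trans.
Qed.

(* The least target [a] is produced from two entries of [d]: from two neighbours
   [u <= a <= v] when they can be chosen below the largest entry [y], so that the
   total is preserved, and otherwise from the smallest entry [x] and [y], where
   the other output [z] can be taken in an interval. *)
Lemma realizable_of_sums (R : rcfType) (n : nat) (d c : seq R) :
  size d = n.+1 -> size c = n.+1 ->
  pairwise <=%R d -> pairwise <=%R c -> all (> 0) d -> all (> 0) c ->
  (forall k, \sum_(x <- take k d) x <= \sum_(x <- take k c) x) ->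
  2 * last 0 c - \sum_(x <- c) x <= 2 * last 0 d - \sum_(x <- d) x ->
  realizable d c.
Proof.
elim: n d c => [|n IHn] d c.
  case: d => [|x [|//]] //; case: c => [|a [|//]] // _ _ _ _ _ _ hk hl.
  have := hk 1%N; move: hl; rewrite /= !big_seq1 => h1 h2.
  have -> : x = a by lra.
  exact: realizable1.
case: d => [|x d] // [sd]; case: c => [|a c] // [sc].
rewrite !pairwise_cons => /andP[xd pd] /andP[ac pc] /= /andP[x0 d0] /andP[a0 c0] hk hl.
have xa : x <= a by have := hk 1%N; rewrite /= !take0 !big_seq1.
case/lastP: d sd xd pd d0 hk hl => [//|m y]; rewrite size_rcons => -[sm] xd pd d0 hk hl.
case/lastP: c sc ac pc c0 hk hl => [//|e b]; rewrite size_rcons => -[se] ac pc c0 hk hl.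
(* The largest entry [y] is kept out of the search: it stays last in the new list, so the last
   inequality survives. *)
have [[l1 [u [v [l2 [xmE /andP[ua av]]]]]]|xma] := split_crossing m xa.
  have dE : x :: rcons m y = l1 ++ u :: v :: rcons l2 y.
    by rewrite -rcons_cons xmE rcons_cat.
  set z := u + v - a.
  have pall : pairwise <=%R (l1 ++ u :: v :: rcons l2 y).
    by rewrite -dE pairwise_cons xd.
  have posall : all (> 0) (l1 ++ u :: v :: rcons l2 y) by rewrite -dE /= x0.
  have sall : size (l1 ++ z :: rcons l2 y) = n.+1.
    have := congr1 size dE; rewrite /= size_rcons sm !size_cat /= size_rcons.
    by rewrite !addnS => -[<-].
  have [u0 v0] : 0 < u /\ 0 < v.
    by move: posall; rewrite all_cat /= => /and4P[].
  have uz : u <= z <= v by rewrite /z; lra.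
  rewrite dE; apply: (@realizable_perm _ (u :: v :: (l1 ++ rcons l2 y))).
  - rewrite -[u :: v :: _]/([:: u; v] ++ _) -[u :: v :: rcons _ _]/([:: u; v] ++ _).
    by rewrite perm_catCA.
  - by rewrite /= size_rcons se -sall !size_cat /= addnS.
  apply: (@realizable_cons _ _ _ z); rewrite ?size_rcons //; try (rewrite /z; lra).
  apply: (@realizable_perm _ (l1 ++ z :: rcons l2 y)).
  - by rewrite -[z :: rcons _ _]/([:: z] ++ _) perm_catCA.
  - by rewrite sall size_rcons se.
  apply: IHn; rewrite ?size_rcons ?se //.
  - exact: pairwise_le_replace pall.
  - move: posall; rewrite !all_cat /= => /and4P[-> _ _ ->]; rewrite andbT.
    by rewrite (lt_le_trans u0) //; case/andP: uz.
  - have l1a : all (<= a) l1.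
      move: pall; rewrite pairwise_cat allrel_consr => /and3P[/andP[l1u _] _ _].
      by apply: sub_all l1u => w /le_trans; apply.
    have sl : (size l1 <= n)%N.
      by move: sall; rewrite size_cat /= addnS => -[<-]; apply: leq_addr.
    (* A prefix inside [l1] has entries at most [a], while the remaining targets are at least [a]. A
       longer prefix contains [z], and [u + v = a + z] reduces it to the old inequality for
       [k.+1]. *)
    move=> k; have [kl|lk] := leqP k (size l1).
      rewrite takel_cat //; apply: (@sum_le_sum_of_le _ a).
      + by rewrite !size_takel // size_rcons se ltnW // ltnS (leq_trans kl).
      + by apply/allP => w /mem_take; apply/allP.
      by apply/allP => w /mem_take; apply/allP.
    have := hk k.+1; rewrite dE.
    rewrite !take_cat (leq_gtF (leqW (ltnW lk))) (leq_gtF (ltnW lk)).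
    rewrite subSn ?(ltnW lk) //.
    have -> : (k - size l1 = (k - (size l1).+1).+1)%N by rewrite subnSK.
    rewrite /= !big_cat /= !big_cons /z; lra.
  - move: hl; rewrite dE !last_cat /= !last_rcons !big_cat /= !big_cons /z.
    lra.
(* Without a crossing all entries but [y] are at most [a], so of the partial sum inequalities only
   the total one is still needed. *)
have {hk} hs := hk (size (x :: rcons m y)).
move: hs hl; rewrite take_size take_oversize; last by rewrite /= !size_rcons sm se.
rewrite !last_rcons !big_cons !big_rcons /= => hs hl.
have [ma ea] : all (<= a) m /\ all (>= a) e.
  split; first by move: xma => /= /andP[].
  by move: ac; rewrite all_rcons => /andP[].
have hme : \sum_(w <- m) w <= \sum_(w <- e) w.
  by apply: (@sum_le_sum_of_le _ a); rewrite // sm se.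
set S := \sum_(w <- e) w - \sum_(w <- m) w.
have [ab my] : a <= b /\ all (<= y) m.
  split; first by move: ac; rewrite all_rcons => /andP[].
  by move: pd; rewrite -cats1 pairwise_cat allrel_consr => /and3P[/andP[]].
have [xy y0] : x <= y /\ 0 < y.
  by split; [move: xd | move: d0]; rewrite all_rcons => /andP[].
(* [z1], [z2] and [z5] are the conditions for a two-mode step from [(x, y)] to [(a, z)]; [z3] is the
   new last inequality, [z6] the new total one, and [z4] makes [z] the largest entry. The greatest
   lower bound on the list is the witness. *)
have [z [z1 z2 z3 z4 [z5 z6]]] : exists z, [/\ y - (a - x) <= z, a + x - y <= z,
    b - S <= z, Num.min a y <= z & z <= y + (a - x) /\ z <= b + S].
  exists (Num.max (Num.max (y - (a - x)) (a + x - y)) (Num.max (b - S) (Num.min a y))).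
  have minE : Num.min a y <= a by rewrite ge_min lexx.
  set w := Num.min a y in minE *.
  split; rewrite ?(le_max, lexx, orbT) //.
  by split; rewrite !ge_max -!andbA; apply/and4P; split; rewrite /S; lra.
have mz : all (<= z) m.
  apply/allP => w wm; apply: le_trans z4.
  by rewrite le_min; apply/andP; split; [exact: (allP ma) | exact: (allP my)].
have z0 : 0 < z by apply: lt_le_trans z4; rewrite lt_min a0.
apply: (@realizable_perm _ (x :: y :: m)).
- by rewrite perm_cons perm_sym perm_rcons.
- by rewrite /= size_rcons sm se.
apply: (@realizable_cons _ _ _ z); rewrite ?size_rcons //; try lra.
apply: (@realizable_perm _ (rcons m z)).
- by rewrite perm_rcons.
- by rewrite !size_rcons sm se.
apply: IHn; rewrite ?size_rcons ?sm ?se //.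
- rewrite -cats1 pairwise_cat allrel_consr mz allrel0r /=.
  by move: pd; rewrite -cats1 pairwise_cat => /and3P[_ -> _].
- by rewrite all_rcons z0; move: d0; rewrite all_rcons => /andP[].
- move=> k; have [km|mk] := leqP k (size m).
    rewrite -!cats1 !takel_cat ?se -?sm //; apply: (@sum_le_sum_of_le _ a).
    + by rewrite !size_takel // se -sm.
    + by apply/allP => w /mem_take; apply/allP.
    by apply/allP => w /mem_take; apply/allP.
  rewrite !take_oversize ?size_rcons ?se -?sm // !big_rcons /=.
  by move: z6; rewrite /S; lra.
by move: z3; rewrite !last_rcons !big_rcons /= /S; lra.
Qed.

(** * Symplectic matrices and sufficiency *)

Lemma mul_mxdiag (R : pzSemiRingType) (p : nat) (p_ : 'I_p -> nat)
    (A B : forall i, 'M[R]_(p_ i)) :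
  \mxdiag_i A i *m \mxdiag_i B i = \mxdiag_i (A i *m B i).
Proof.
rewrite {2 3}/mxdiag mul_mxdiag_mxblock; apply/eq_mxblock => i j.
by case: eqVneq => [->|_]; rewrite ?conform_mx_id ?mulmx0.
Qed.

Lemma sigma1_tr (R : realType) : (sigma1 R)^T = - sigma1 R.
Proof. by rewrite /sigma1 linearB /= !trmx_delta opprB. Qed.

Lemma sigma1_sqr (R : realType) : sigma1 R *m sigma1 R = - 1%:M.
Proof.
apply/matrixP=> [[[|[|//]] i] [[|[|//]] j]];
  rewrite !mxE !big_ord_recl big_ord0 !mxE /=; ring.
Qed.

Lemma sigma_tr (R : realType) n : (sigma R n)^T = - sigma R n.
Proof.
by rewrite /sigma tr_mxdiag -mxdiagN; apply: eq_mxdiag => k; rewrite sigma1_tr.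
Qed.

Lemma sigma_sqr (R : realType) n : sigma R n *m sigma R n = - 1%:M.
Proof.
rewrite /sigma mul_mxdiag -mxdiagZ -mxdiagN.
by apply: eq_mxdiag => k; rewrite sigma1_sqr.
Qed.

Lemma symplectic_unitmx (R : realType) n (S : modemx R n) :
  symplectic S -> S \in unitmx.
Proof.
move=> hS; case: (@mulmx1_unit _ _ S (- (sigma R n *m S^T *m sigma R n))) => //.
by rewrite mulmxN !mulmxA hS sigma_sqr opprK.
Qed.

Lemma symplectic_inv (R : realType) n (S : modemx R n) :
  symplectic S -> symplectic (invmx S).
Proof.
move=> hS; have uS := symplectic_unitmx hS.
rewrite /symplectic -{1}hS trmx_inv !mulmxA mulVmx // mul1mx -mulmxA mulmxV ?mulmx1 //.
by rewrite unitmx_tr.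
Qed.

Lemma symplectic_mul (R : realType) n (S T : modemx R n) :
  symplectic S -> symplectic T -> symplectic (S *m T).
Proof.
by rewrite /symplectic => hS hT; rewrite trmx_mul !mulmxA -(mulmxA S) -(mulmxA S) hT.
Qed.

Lemma strictly_positive_congr (R : realType) n (T : modemx R n) (d : 'I_n -> R) :
  T \in unitmx -> (forall k, 0 < d k) ->
  strictly_positive (T *m \mxdiag_(k < n) (d k)%:M *m T^T).
Proof.
move=> uT d0; split.
  rewrite !trmx_mul trmxK tr_mxdiag mulmxA; congr (_ *m _ *m _).
  by apply: eq_mxdiag => k; rewrite tr_scalar_mx.
move=> x x0; set y := x *m T.
have y0 : y != 0.
  by apply: contra x0 => /eqP yT; rewrite -(mulmxK uT x) -/y yT mul0mx.
have -> : x *m (T *m \mxdiag_(k < n) (d k)%:M *m T^T) *m x^T =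
   y *m \mxdiag_(k < n) (d k)%:M *m y^T by rewrite /y trmx_mul !mulmxA.
clearbody y.
have /existsP[j yj] : [exists j, y 0 j != 0].
  apply: contra_neqT y0 => /existsPn yn; apply/rowP => j; rewrite [RHS]mxE.
  by apply/eqP; move: (yn j); rewrite negbK.
have -> : \mxdiag_(k < n) (d k)%:M = diag_mx (\mxrow_(k < n) const_mx (d k)) :> modemx R n.
  by rewrite diag_mxrow; apply: eq_mxdiag => k; rewrite diag_const_mx.
rewrite mul_mx_diag mxE (bigD1 j) //= !mxE.
apply: ltr_pwDl.
  by rewrite mulrAC -expr2 mulr_gt0 // lt_neqAle sqr_ge0 eq_sym sqrf_eq0 yj.
apply: sumr_ge0 => i _; rewrite !mxE mulrAC -expr2 mulr_ge0 ?sqr_ge0 //.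
exact: ltW.
Qed.

(** A block of a matrix acting separately on the position and the momentum of each mode. *)
Definition split_block (R : realType) (g h : R) : 'M[R]_2 :=
  diag_mx (\row_(a < 2) if a == 0 then g else h).

(** Summed over the modes, the two coefficients become entries of [G H^T] and of its transpose, so
    [G H^T = 1] is the symplectic relation. *)
Lemma split_block_sigma1 (R : realType) (g h g' h' : R) :
  split_block g h *m sigma1 R *m (split_block g' h')^T =
  (g * h') *: delta_mx 0 1 - (g' * h) *: delta_mx 1 0.
Proof.
apply/matrixP=> [[[|[|//]] i] [[|[|//]] j]];
  rewrite /split_block tr_diag_mx mul_mx_diag mul_diag_mx !mxE /=; ring.
Qed.

Lemma split_block_scalar (R : realType) (g h a : R) :
  split_block g h *m a%:M *m (split_block g h)^T =
  split_block (g ^+ 2 * a) (h ^+ 2 * a).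
Proof.
apply/matrixP=> [[[|[|//]] i] [[|[|//]] j]];
  rewrite /split_block tr_diag_mx mul_mx_diag mul_diag_mx !mxE /=; ring.
Qed.

Lemma split_block_sum (R : realType) (I : finType) (g h : I -> R) :
  \sum_i split_block (g i) (h i) = split_block (\sum_i g i) (\sum_i h i).
Proof.
apply/matrixP=> a b; rewrite summxE !mxE.
by case: ifP => b0; rewrite -sumrMnl; apply: eq_bigr => i _; rewrite !mxE b0.
Qed.

Lemma nth_image_ord (R : nmodType) (n : nat) (f : 'I_n -> R) (k : 'I_n) :
  [seq f j | j : 'I_n]`_k = f k.
Proof. by rewrite (nth_map k) ?size_enum_ord // nth_ord_enum. Qed.

Lemma gamma_of_realizable (R : realType) (n : nat) (d c : 'I_n.+1 -> R) :
  (forall k, 0 < d k) -> (forall k, 0 < c k) ->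
  realizable [seq d k | k : 'I_n.+1] [seq c k | k : 'I_n.+1] ->
  exists gamma : modemx R n.+1,
    [/\ strictly_positive gamma, symplectic_eigenvalues gamma d &
        symplectic_main_diagonal gamma c].
Proof.
move=> d0 c0 [G [H []]]; rewrite size_map size_enum_ord => gh diag.
pose T : modemx R n.+1 := \mxblock_(k < n.+1, j < n.+1) split_block (G k j) (H k j).
pose D : modemx R n.+1 := \mxdiag_(k < n.+1) (d k)%:M.
have sT : symplectic T.
  rewrite /symplectic /sigma /T mul_mxblock_mxdiag tr_mxblock mul_mxblock.
  have ghE (i j : 'I_n.+1) : \sum_(k < n.+1) G i k * H j k = (i == j)%:R.
    by have := gh i j (ltn_ord i) (ltn_ord j); rewrite big_mkord.
  apply/eq_mxblock => i j.
  under eq_bigr do rewrite split_block_sigma1.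
  rewrite sumrB -!scaler_suml !ghE (eq_sym j).
  case: eqVneq => [_|_]; rewrite ?conform_mx_id ?scale1r // !scale0r subrr //.
have uT := symplectic_unitmx sT.
exists (T *m D *m T^T); split.
- exact: strictly_positive_congr.
- split=> //; exists (invmx T); first exact: symplectic_inv.
  rewrite !mulmxA mulVmx // mul1mx -mulmxA -trmx_mul mulVmx //.
  by rewrite trmx1 mulmx1.
(* The diagonal block is already [c k] times the identity. *)
move=> k; split=> //; exists 1%:M.
  by rewrite /symplectic mul1mx trmx1 mulmx1.
rewrite mul1mx trmx1 mulmx1; apply: eq_mxdiag => _.
rewrite /T mul_mxblock_mxdiag tr_mxblock mul_mxblock mxblockK.
under eq_bigr do rewrite split_block_scalar.
have [gk hk] := diag k (ltn_ord k).
rewrite split_block_sum (eq_bigr (fun i : 'I_n.+1 => G k i ^+ 2 * [seq d k | k : 'I_n.+1]`_i)).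
  rewrite [X in split_block _ X](eq_bigr (fun i : 'I_n.+1 => H k i ^+ 2 * [seq d k | k : 'I_n.+1]`_i)).
    move: gk hk; rewrite !big_mkord => -> ->; rewrite nth_image_ord /split_block -diag_const_mx.
    by congr diag_mx; apply/rowP => a; rewrite !mxE; case: ifP.
  by move=> i _; rewrite nth_image_ord.
by move=> i _; rewrite nth_image_ord.
Qed.

(** * Necessity *)

Lemma mxtrace_mul_tr_ge0 (R : realDomainType) (m n : nat) (A : 'M[R]_(m, n)) :
  0 <= \tr (A *m A^T).
Proof.
apply: sumr_ge0 => i _; rewrite mxE; apply: sumr_ge0 => j _.
by rewrite mxE -expr2 sqr_ge0.
Qed.

Lemma mxtrace_amgm (R : realDomainType) (m n : nat) (A B : 'M[R]_(m, n)) :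
  \tr (A *m B^T) *+ 2 <= \tr (A *m A^T) + \tr (B *m B^T).
Proof.
have := mxtrace_mul_tr_ge0 (A - B).
have e : \tr (B *m A^T) = \tr (A *m B^T) by rewrite -mxtrace_tr trmx_mul trmxK.
rewrite [(A - B)^T]linearB /= mulmxBl !mulmxBr !linearB /= e mulr2n; lra.
Qed.

Lemma mul_tr_eq0 (R : realDomainType) (m n : nat) (A : 'M[R]_(m, n)) :
  A *m A^T = 0 -> A = 0.
Proof.
move=> AA; apply/matrixP => i j; move/matrixP/(_ i i): AA; rewrite !mxE => /eqP.
under eq_bigr do rewrite mxE -expr2.
rewrite psumr_eq0 => [/allP x0|k _]; last exact: sqr_ge0.
by apply/eqP; rewrite -sqrf_eq0; apply: x0; rewrite mem_index_enum.
Qed.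

(** For a row basis [B] of [K] the Gram matrix [B *m B^T] is invertible, and [B^T (B B^T)^-1 B] is
    the projector. *)
Lemma orthogonal_projector (R : realFieldType) (n : nat) (K : 'M[R]_n) :
  exists P : 'M[R]_n,
    [/\ P^T = P, P *m P = P, (P <= K)%MS & \tr P = (\rank K)%:R].
Proof.
have : (row_base K <= K)%MS by rewrite eq_row_base.
have := row_base_free K; move: (row_base K) => B fB sB.
have uB : B *m B^T \in unitmx.
  rewrite -row_free_unit; apply: inj_row_free => x xBB.
  have xB : x *m B = 0.
    by apply: mul_tr_eq0; rewrite trmx_mul mulmxA -(mulmxA x) xBB mul0mx.
  by apply: (row_free_inj fB); rewrite mul0mx.
exists (B^T *m invmx (B *m B^T) *m B); split.
- by rewrite !trmx_mul trmxK trmx_inv trmx_mul trmxK mulmxA.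
- by rewrite !mulmxA -(mulmxA _ B B^T) -(mulmxA _ (B *m B^T)) mulmxV // mulmx1.
- exact: submx_trans (submxMl _ _) sB.
by rewrite mxtrace_mulC mulmxA mulmxV // mxtrace1.
Qed.

Lemma skew_mx2 (R : realType) (S : 'M[R]_2) : S^T = - S -> S = S 0 1 *: sigma1 R.
Proof.
move=> /matrixP St.
have := St 0 0; have := St 1 1; have := St 0 1; rewrite !mxE => h01 h11 h00.
have e (a b : 'I_2) : S a b = if a == b then 0 else if a == 0 then S 0 1 else - S 0 1.
  have [-> | ->] : a = 0 \/ a = 1.
  - by case: a => -[|[|//]] ?; [left | right]; apply: val_inj.
  - have [-> | ->] : b = 0 \/ b = 1.
    + by case: b => -[|[|//]] ?; [left | right]; apply: val_inj.
    + by rewrite eqxx; lra.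
    by [].
  have [-> | ->] : b = 0 \/ b = 1.
  - by case: b => -[|[|//]] ?; [left | right]; apply: val_inj.
  - by rewrite /=; lra.
  by rewrite eqxx; lra.
apply/matrixP=> a b; rewrite e !mxE.
by case: a b => [[|[|//]] ?] [[|[|//]] ?] /=; ring.
Qed.

(* [U] is the complex reflection, for the complex structure [J], that exchanges
   the complex vectors encoded by [Y *m J] and by [- sigma1 *m Y]; their
   difference spans the rows of [W]. *)
Lemma complex_reflection (R : realType) (n : nat) (J : 'M[R]_n)
    (Y : 'M[R]_(2, n)) (c : R) :
  J^T = - J -> J *m J = - 1%:M -> Y *m Y^T = c%:M ->
  sigma1 R *m Y *m J != Y ->
  exists U : 'M[R]_n,
    [/\ U^T = U, U *m U = 1%:M, U *m J = J *m U,
        Y *m J *m U = - (sigma1 R *m Y) &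
        forall (D : 'M[R]_n) (b : R),
          (forall X : 'M[R]_(2, n), \tr (X *m D *m X^T) <= b * \tr (X *m X^T)) ->
          \tr D - 4 * b <= \tr (D *m U)].
Proof.
move=> Jt JJ YY neq; set j := sigma1 R.
have jt : j^T = - j by apply: sigma1_tr.
have jj : j *m j = - 1%:M by apply: sigma1_sqr.
set W := j *m Y *m J - Y.
have W0 : W != 0 by rewrite subr_eq0.
set S := Y *m J *m Y^T.
have [s sE] : exists s, S = s *: j.
  by exists (S 0 1); apply: skew_mx2; rewrite /S !trmx_mul trmxK Jt mulNmx mulmxN mulmxA.
set q := 2 * (c + s).
have YJW : Y *m J *m W^T = - (c + s) *: j.
  rewrite /W linearB /= !trmx_mul mulmxBr -/S sE Jt jt.
  rewrite !(mulmxN, mulNmx) opprK !mulmxA -(mulmxA _ J J) JJ mulmxN mulNmx mulmx1.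
  by rewrite YY mulNmx scaleNr scalerDl mul_scalar_mx opprD.
(* The two rows of [W] are orthogonal of equal squared norm [q], so [W^T *m W] divided by [q] is an
   orthogonal projector. *)
have WW : W *m W^T = q%:M.
  rewrite {1}/W mulmxBl -!mulmxA (mulmxA Y) YJW.
  have -> : Y *m W^T = - (c + s)%:M.
    rewrite /W linearB /= !trmx_mul mulmxBr YY Jt jt.
    rewrite !(mulmxN, mulNmx) opprK !mulmxA -/S sE -scalemxAl jj.
    by rewrite scalerN scalemx1 -opprD -raddfD /= addrC.
  rewrite -scalemxAr jj scaleNr scalerN opprK scalemx1 opprK -raddfD /= /q.
  by congr (_%:M); ring.
have q0 : q != 0.
  by apply: contra W0 => /eqP q0; apply/eqP/mul_tr_eq0; rewrite WW q0 raddf0.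
have q_gt0 : 0 < q.
  have := mxtrace_mul_tr_ge0 W; rewrite WW mxtrace_scalar pmulrn_lge0 // => q_ge0.
  by rewrite lt_neqAle eq_sym q0.
(* The row space of [W] is stable under [J], which makes the reflection complex linear. *)
have WJ : W *m J = j *m W.
  rewrite /W mulmxBl mulmxBr -(mulmxA _ J J) JJ mulmxN mulmx1 !mulmxA jj mulNmx.
  by rewrite mul1mx mulNmx addrC.
have JWt : J *m W^T = W^T *m j.
  apply: trmx_inj; rewrite !trmx_mul trmxK Jt jt mulmxN mulNmx.
  by rewrite WJ.
have WE : W = j *m Y *m J - Y by [].
clearbody W.
exists (1%:M - (2 / q) *: (W^T *m W)); split.
- by rewrite linearB /= linearZ /= trmx_mul trmxK tr_scalar_mx.
- set X := W^T *m W; have XX : X *m X = q *: X.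
    by rewrite /X mulmxA -(mulmxA W^T) WW mul_mx_scalar -scalemxAl.
  rewrite mulmxBr mulmx1 mulmxBl mul1mx -scalemxAl -scalemxAr XX !scalerA.
  have -> : 2 / q * (2 / q) * q = 2 / q + 2 / q by field.
  by rewrite scalerDl opprB addrK subrK.
- rewrite mulmxBl mulmxBr mul1mx mulmx1 -scalemxAl -scalemxAr.
  by rewrite -mulmxA WJ !mulmxA JWt.
- rewrite mulmxBr mulmx1 -scalemxAr mulmxA YJW -scalemxAl scalerA.
  have -> : 2 / q * - (c + s) = -1 by rewrite /q in q0 *; field; move: q0; rewrite mulf_eq0 => /norP[].
  rewrite scaleN1r opprK WE mulmxBr !mulmxA jj !mulNmx mul1mx.
  by rewrite addrA subrr add0r.
(* The loss is [2 / q] times [\tr (W *m D *m W^T)], and [W] has squared norm [2 * q], whence the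
   constant 4. *)
move=> D b Db.
rewrite mulmxBr mulmx1 linearB /= -scalemxAr linearZ /=.
rewrite mulmxA mxtrace_mulC mulmxA.
have := Db W; rewrite WW mxtrace_scalar => WDW.
have : 2 / q * \tr (W *m D *m W^T) <= 2 / q * (b * (q *+ 2)).
  by rewrite ler_pM2l // divr_gt0.
have -> : 2 / q * (b * (q *+ 2)) = 4 * b by field.
lra.
Qed.

(** * Mode-wise diagonal matrices and mode projectors *)

Lemma symplectic_tr (R : realType) n (S : modemx R n) :
  symplectic S -> S^T *m sigma R n *m S = sigma R n.
Proof.
move=> hS.
have : - (sigma R n *m S^T *m sigma R n) *m S = 1%:M.
  by apply: mulmx1C; rewrite mulmxN !mulmxA hS sigma_sqr opprK.
move/(congr1 (mulmx (sigma R n))); rewrite mulmx1 => {2}<-.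
by rewrite mulNmx mulmxN !mulmxA sigma_sqr !mulNmx mul1mx opprK.
Qed.

Definition mode_diag (R : realType) n (f : 'I_n -> R) : modemx R n :=
  \mxdiag_(k < n) (f k)%:M.

Definition mode_proj (R : realType) n (P : pred 'I_n) : modemx R n :=
  mode_diag (fun k => (P k)%:R).

Lemma mode_diag_tr (R : realType) n (f : 'I_n -> R) :
  (mode_diag f)^T = mode_diag f.
Proof. by rewrite tr_mxdiag; apply: eq_mxdiag => k; rewrite tr_scalar_mx. Qed.

Lemma mode_diag_mul (R : realType) n (f g : 'I_n -> R) :
  mode_diag f *m mode_diag g = mode_diag (fun k => f k * g k).
Proof. by rewrite mul_mxdiag; apply: eq_mxdiag => k; rewrite scalar_mxM. Qed.

Lemma mode_diag_sigma (R : realType) n (f : 'I_n -> R) :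
  mode_diag f *m sigma R n = sigma R n *m mode_diag f.
Proof. by rewrite !mul_mxdiag; apply: eq_mxdiag => k; rewrite scalar_mxC. Qed.

Lemma mxtrace_mul_mode_diag (R : realType) n (A : modemx R n) (f : 'I_n -> R) :
  \tr (A *m mode_diag f) = \sum_k f k * \tr (submxblock A k k).
Proof.
rewrite -{1}(submxblockK A) mul_mxblock_mxdiag mxtrace_mxblock.
by apply: eq_bigr => k _; rewrite mul_mx_scalar mxtraceZ.
Qed.

Lemma mode_diag_sum (R : realType) n (I : finType) (P : pred I) (f : I -> 'I_n -> R) :
  \sum_(i | P i) mode_diag (f i) = mode_diag (fun k => \sum_(i | P i) f i k).
Proof. by rewrite -mxdiag_sum; apply: eq_mxdiag => k; rewrite raddf_sum. Qed.

Lemma mode_projC (R : realType) n (P : pred 'I_n) :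
  mode_proj R (predC P) = 1%:M - mode_proj R P.
Proof.
rewrite -mxdiagZ -mxdiagB; apply: eq_mxdiag => k /=.
by rewrite -raddfB /=; case: (P k); rewrite ?subrr ?subr0.
Qed.

Lemma mode_proj_idem (R : realType) n (P : pred 'I_n) :
  mode_proj R P *m mode_proj R P = mode_proj R P.
Proof.
by rewrite mode_diag_mul; apply: eq_mxdiag => k; rewrite -natrM mulnb andbb.
Qed.

Lemma mxrank_mode_proj (R : realType) n (P : pred 'I_n) :
  \rank (mode_proj R P) = (2 * #|P|)%N.
Proof.
rewrite rank_mxdiag -sum1_card big_distrr /= [RHS]big_mkcond /=.
apply: eq_bigr => k _; rewrite unfold_in.
by case: (P k); rewrite ?raddf0 ?mxrank0 ?mxrank1.
Qed.

(** The trace is the squared norm of a sub-block, because mode projectors are symmetric and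
    idempotent. *)
Lemma mxtrace_mode_proj (R : realType) n (A : modemx R n) (P Q : pred 'I_n) :
  \tr (mode_proj R P *m A *m mode_proj R Q *m A^T) =
  \tr ((mode_proj R P *m A *m mode_proj R Q) *m (mode_proj R P *m A *m mode_proj R Q)^T).
Proof.
rewrite !trmx_mul !mode_diag_tr !mulmxA -(mulmxA _ (mode_proj R Q) (mode_proj R Q)) mode_proj_idem.
by rewrite [RHS]mxtrace_mulC !mulmxA mode_proj_idem.
Qed.

(* With [A = E T F], [E T F'] kills at most [2 |~: Q|] dimensions, so there is an
   orthogonal projector [Pi] of rank at least [2 |P :&: Q|] on which
   [A sigma A^T] agrees with [sigma]; then [tr Pi = <Pi A sigma, sigma A>] is at
   most [tr (A A^T)] by the AM-GM inequality. *)
Lemma mode_overlap (R : realType) n (T : modemx R n) (P Q : pred 'I_n) :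
  symplectic T -> (forall k, P k || Q k) ->
  (2 * #|[pred k | P k && Q k]|)%:R <=
    \tr (mode_proj R P *m T *m mode_proj R Q *m T^T).
Proof.
move=> sT PQ; set E := mode_proj R P; set F := mode_proj R Q.
have FF : F *m F = F by apply: mode_proj_idem.
have Es : E *m sigma R n = sigma R n *m E by apply: mode_diag_sigma.
have Fs : F *m sigma R n = sigma R n *m F by apply: mode_diag_sigma.
have Et : E^T = E by apply: mode_diag_tr.
have Ft : F^T = F by apply: mode_diag_tr.
set A := E *m T *m F.
rewrite mxtrace_mode_proj -/A.
set E' := mode_proj R (predC P); set F' := mode_proj R (predC Q).
set X := E *m T *m F'.
(* Membership in this kernel means both [Pi *m E = Pi] and [Pi *m X = 0]. *)
have [Pi [Pt PP PK trP]] := orthogonal_projector (kermx (row_mx E' X)).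
have /sub_kermxP := PK; rewrite mul_mx_row => /eqP.
rewrite -[X in _ == X]row_mx0 => /eqP/eq_row_mx[PE' PX].
have PE : Pi *m E = Pi.
  by move: PE'; rewrite /E' mode_projC mulmxBr mulmx1 => /eqP; rewrite subr_eq0 => /eqP.
(* The kernel has dimension at least [2n - 2(n - |P|) - 2(n - |Q|)], which is [2 |P :&: Q|] because
   [P] and [Q] cover all modes. *)
have rk : (2 * #|[pred k | P k && Q k]| <= \rank (kermx (row_mx E' X)))%N.
  rewrite mxrank_ker -mxrank_tr tr_row_mx -addsmxE.
  have := leq_trans (mxrank_adds_leqif E'^T X^T).1 (leq_add (leqnn _) (leqnn _)).
  rewrite !mxrank_tr => rs.
  have rX : (\rank X <= \rank F')%N by apply: mxrankM_maxr.
  have rE' := mxrank_mode_proj R (predC P); have rF' := mxrank_mode_proj R (predC Q).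
  have cC (K : pred 'I_n) : (#|K| + #|predC K| = n)%N.
    by rewrite -[RHS]card_ord -(cardC K); congr (_ + _)%N; apply: eq_card.
  have cP := cC P; have cQ := cC Q.
  have cU : (n + #|[pred k | P k && Q k]| = #|P| + #|Q|)%N.
    have cT : #|[predU P & Q]| = n.
      by rewrite -[RHS]card_ord; apply: eq_card => k; rewrite !inE; apply: PQ.
    by rewrite -cardUI cT; congr (_ + _)%N; apply: eq_card.
  have arith m N r e f x p q p' q' u : (x <= f -> e = 2 * p' -> f = 2 * q' ->
      p + p' = m -> q + q' = m -> m + u = p + q -> N = m * 2 -> r <= e + x ->
      2 * u <= N - r)%N by lia.
  apply: (arith n _ _ _ _ _ _ _ _ _ _ rX rE' rF' cP cQ cU _ rs).
  by rewrite sum_nat_const card_ord.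
apply: (@le_trans _ _ (\tr Pi)); first by rewrite trP ler_nat.
have FsF : F *m sigma R n *m F = sigma R n - F' *m sigma R n *m F'.
  rewrite /F' mode_projC -/F mulmxBl mul1mx mulmxBr mulmx1 mulmxBl.
  by rewrite Fs -(mulmxA _ F F) FF subrr subr0 opprB addrC subrK.
have AsA : A *m sigma R n *m A^T = E *m sigma R n *m E - X *m sigma R n *m X^T.
  have -> : A *m sigma R n *m A^T = E *m T *m (F *m sigma R n *m F) *m (T^T *m E).
    by rewrite /A !trmx_mul Et Ft !mulmxA.
  have -> : X *m sigma R n *m X^T = E *m T *m (F' *m sigma R n *m F') *m (T^T *m E).
    by rewrite /X !trmx_mul Et mode_diag_tr !mulmxA.
  rewrite FsF mulmxBr mulmxBl; congr (_ - _).
  by rewrite -[in RHS]sT !mulmxA.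
clearbody A X.
have PA : Pi *m A *m sigma R n *m A^T = Pi *m sigma R n.
  rewrite -!(mulmxA Pi) AsA mulmxBr !(mulmxA Pi) PX !mul0mx subr0.
  by rewrite PE -mulmxA -Es mulmxA PE.
have -> : \tr Pi = \tr (Pi *m A *m sigma R n *m (sigma R n *m A)^T).
  rewrite trmx_mul sigma_tr !mulmxN mulmxA PA.
  by rewrite -(mulmxA Pi) sigma_sqr mulmxN mulmx1 opprK.
have := mxtrace_amgm (Pi *m A *m sigma R n) (sigma R n *m A).
have -> : \tr (Pi *m A *m sigma R n *m (Pi *m A *m sigma R n)^T) = \tr (Pi *m A *m A^T).
  rewrite !trmx_mul sigma_tr Pt mulNmx mulmxN -!mulmxA (mulmxA (sigma R n)).
  rewrite sigma_sqr mulNmx mul1mx !mulmxN opprK [LHS]mxtrace_mulC.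
  by rewrite !mulmxA -(mulmxA _ Pi Pi) PP mxtrace_mulC !mulmxA.
have -> : \tr (sigma R n *m A *m (sigma R n *m A)^T) = \tr (A *m A^T).
  rewrite trmx_mul sigma_tr mxtrace_mulC mulmxN mulNmx !mulmxA.
  by rewrite -(mulmxA A^T (sigma R n)) sigma_sqr mulmxN mulmx1 mulNmx opprK mxtrace_mulC.
(* The difference is the squared norm of [A - Pi *m A]. *)
have : \tr (Pi *m A *m A^T) <= \tr (A *m A^T).
  have := mxtrace_mul_tr_ge0 (A - Pi *m A).
  rewrite [X in _ *m X]linearB /= trmx_mul Pt mulmxBl !mulmxBr !linearB /=.
  have -> : \tr (A *m (A^T *m Pi)) = \tr (Pi *m A *m A^T).
    by rewrite mulmxA mxtrace_mulC mulmxA.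
  have -> : \tr (Pi *m A *m (A^T *m Pi)) = \tr (Pi *m A *m A^T).
    by rewrite mulmxA mxtrace_mulC !mulmxA PP.
  lra.
rewrite mulr2n; lra.
Qed.

(** * Local normal form and the partial sum inequalities *)

Lemma one_mode_mxdiag (R : realType) (A : modemx R 1) :
  A = \mxdiag_(i < 1) submxblock A 0 0.
Proof.
apply/mxblockP => i j; rewrite (ord1 i) (ord1 j).
by rewrite (submxblock_diag (fun _ : 'I_1 => submxblock A 0 0)).
Qed.

(** [T] undoes the diagonalizing [S] and then applies the direct sum of the symplectic matrices that
    normalize the diagonal blocks of [gamma]. *)
Lemma local_normal_form (R : realType) n (gamma : modemx R n) (d c : 'I_n -> R) :
  symplectic_eigenvalues gamma d -> symplectic_main_diagonal gamma c ->
  exists2 T : modemx R n, symplectic T &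
    forall k, submxblock (T *m mode_diag d *m T^T) k k = (c k)%:M.
Proof.
move=> [_ [S sS SgS]] dg.
have /fin_all_exists[L Lk] (k : 'I_n) : exists L : 'M[R]_2,
    L *m sigma1 R *m L^T = sigma1 R /\ L *m submxblock gamma k k *m L^T = (c k)%:M.
  have [_ [U sU Uk]] := dg k; exists (submxblock U 0 0).
  move: sU Uk; rewrite /symplectic /sigma (one_mode_mxdiag U).
  move: (submxblock U 0 0) => V; rewrite submxblock_diag.
  rewrite !tr_mxdiag !mul_mxdiag => h1 h2.
  by split; [exact: (proj2 (eq_mxdiagP _ _) h1 0) | exact: (proj2 (eq_mxdiagP _ _) h2 0)].
pose LL : modemx R n := \mxdiag_k L k.
have sL : symplectic LL.
  rewrite /symplectic /LL tr_mxdiag !mul_mxdiag; apply: eq_mxdiag => k.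
  by case: (Lk k).
have uS := symplectic_unitmx sS.
exists (LL *m invmx S); first exact: symplectic_mul sL (symplectic_inv sS).
move=> k; rewrite -(proj2 (Lk k)).
have -> : LL *m invmx S *m mode_diag d *m (LL *m invmx S)^T = LL *m gamma *m LL^T.
  rewrite trmx_mul /mode_diag -SgS !mulmxA mulmxKV //.
  by rewrite trmx_inv -(mulmxA _ S^T) mulmxV ?mulmx1 ?unitmx_tr.
rewrite /LL tr_mxdiag -{1}(submxblockK gamma) mul_mxdiag_mxblock mul_mxblock_mxdiag.
by rewrite mxblockK.
Qed.

(** The nonnegative total of [v] allows [b] to be raised to the first [d]; its first term is then
    matched exactly, and that [d] is the lower bound for the tail. *)
Lemma abel_ge0 (R : realDomainType) (n : nat) (v d : 'I_n -> R) (b : R) :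
  (forall k, b <= d k) -> (forall i j : 'I_n, (i <= j)%N -> d i <= d j) ->
  (forall l : nat, 0 <= \sum_(j < n | (l <= j)%N) v j) ->
  b * (\sum_j v j) <= \sum_j d j * v j.
Proof.
elim: n v d b => [|n IHn] v d b bd dd vt; first by rewrite !big_ord0 mulr0.
apply: (@le_trans _ _ (d ord0 * \sum_j v j)).
  by apply: ler_wpM2r => //; have := vt 0%N.
rewrite !big_ord_recl mulrDr lerD2l; apply: IHn.
- by move=> k; apply: dd.
- by move=> i j ij; apply: dd.
move=> l; have := vt l.+1; rewrite big_mkcond big_ord_recl /= add0r.
by rewrite [X in _ -> 0 <= X]big_mkcond.
Qed.

Lemma mxtrace_modes (R : realType) n (T : modemx R n) (d c : 'I_n -> R) (P : pred 'I_n) :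
  (forall k, submxblock (T *m mode_diag d *m T^T) k k = (c k)%:M) ->
  \tr (mode_proj R P *m T *m mode_diag d *m T^T) = 2 * \sum_(k | P k) c k.
Proof.
move=> hc; rewrite -2!(mulmxA (mode_proj R P)) mxtrace_mulC mxtrace_mul_mode_diag.
rewrite big_distrr /= [RHS]big_mkcond /=; apply: eq_bigr => k _.
by rewrite hc mxtrace_scalar; case: (P k); rewrite ?mul0r // mul1r mulr_natl.
Qed.

Lemma mode_diag_scale (R : realType) n (a : R) (f : 'I_n -> R) :
  a *: mode_diag f = mode_diag (fun k => a * f k).
Proof. by rewrite -mul_scalar_mx -mxdiagZ mode_diag_mul. Qed.

(** Let [w j] be the squared norm of the columns of mode [j] in [E *m T]. The [w j] weighted by [d]
    add up to twice the sum of the [c] in [P], and Abel summation compares them with the weights 2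
    on [P]. *)
Lemma sum_smallest_le (R : realType) n (T : modemx R n) (d c : 'I_n -> R) (m : nat) :
  symplectic T -> (forall k, 0 <= d k) ->
  (forall i j : 'I_n, (i <= j)%N -> d i <= d j) ->
  (forall k, submxblock (T *m mode_diag d *m T^T) k k = (c k)%:M) ->
  \sum_(j < n | (j <= m)%N) d j <= \sum_(j < n | (j <= m)%N) c j.
Proof.
move=> sT d0 dd hc; set P := fun j : 'I_n => (j <= m)%N.
set E := mode_proj R P.
pose w j := \tr (E *m T *m mode_proj R (pred1 j) *m T^T).
have wsum (Q : pred 'I_n) :
    \sum_(j | Q j) w j = \tr (E *m T *m mode_proj R Q *m T^T).
  rewrite -raddf_sum /= -mulmx_suml -mulmx_sumr mode_diag_sum.
  congr (\tr (_ *m _ *m _)); apply: eq_mxdiag => k.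
  congr (_%:M); rewrite /=; case Qk: (Q k).
    rewrite (bigD1 k) //= eqxx big1 ?addr0 // => j /andP[_ jk].
    by rewrite eq_sym (negPf jk).
  by rewrite big1 // => j Qj; case: eqVneq => // kj; rewrite kj Qj in Qk.
have wd : \sum_j d j * w j = \tr (E *m T *m mode_diag d *m T^T).
  under eq_bigr do rewrite -mxtraceZ scalemxAl scalemxAr mode_diag_scale.
  rewrite -raddf_sum /= -mulmx_suml -mulmx_sumr mode_diag_sum.
  congr (\tr (_ *m _ *m _)); apply: eq_mxdiag => k; congr (_%:M).
  rewrite (bigD1 k) //= eqxx mulr1 big1 ?addr0 // => j jk.
  by rewrite eq_sym (negPf jk) mulr0.
have := @abel_ge0 R n (fun j => w j - 2 * (P j)%:R) d 0 d0 dd.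
rewrite mul0r => h.
suff : 0 <= \sum_j d j * (w j - 2 * (P j)%:R).
  under eq_bigr do rewrite mulrBr.
  rewrite sumrB wd (mxtrace_modes _ hc).
  have -> : \sum_(i < n) d i * (2 * (P i)%:R) = 2 * \sum_(i | P i) d i.
    rewrite big_distrr [RHS]big_mkcond /=; apply: eq_bigr => i _.
    by case: (P i); rewrite ?mulr0 // mulr1 mulrC.
  lra.
apply: h => l; rewrite sumrB wsum.
have -> : \sum_(i < n | (l <= i)%N) 2 * (P i)%:R
    = (2 * #|[pred i : 'I_n | P i && (l <= i)%N]|)%:R :> R.
  rewrite natrM -sum1_card natr_sum big_distrr /= big_mkcond [RHS]big_mkcond /=.
  apply: eq_bigr => k _; rewrite unfold_in /=.
  by case: (P k); case: (l <= k)%N; rewrite ?mulr0.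
(* For [l <= m] the modes up to [m] and those from [l] on cover everything, as [mode_overlap]
   requires; for larger [l] they are disjoint and nonnegativity of the trace suffices. *)
rewrite subr_ge0; have [lm|ml] := leqP l m.
  apply: mode_overlap => // k; rewrite /P; lia.
have -> : #|[pred i : 'I_n | P i && (l <= i)%N]| = 0%N.
  apply: eq_card0 => k; rewrite !inE /P; lia.
by rewrite mxtrace_mode_proj; apply: mxtrace_mul_tr_ge0.
Qed.

(** * The inequality for the last mode *)

Definition mode_rows (R : realType) n (i : 'I_n) : 'M[R]_(2, \sum_(k < n) 2) :=
  \mxrow_(j < n) (if j == i then 1%:M else 0).

Lemma mode_rows_sigma (R : realType) n (i : 'I_n) :
  mode_rows R i *m sigma R n = sigma1 R *m mode_rows R i.
Proof.
rewrite mul_mxrow_mxdiag mul_mxrow; apply: eq_mxrow => j.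
by case: ifP; rewrite ?mul1mx ?mulmx1 ?mul0mx ?mulmx0.
Qed.

Lemma mode_rows_submxblock (R : realType) n (i : 'I_n) (A : modemx R n) :
  mode_rows R i *m A *m (mode_rows R i)^T = submxblock A i i.
Proof.
rewrite -{1}(submxblockK A) tr_mxrow mul_mxrow_mxblock mul_mxrow_mxcol.
have rowA k : \sum_j (if j == i then 1%:M else 0) *m submxblock A j k = submxblock A i k.
  rewrite (bigD1 i) //= eqxx mul1mx big1 ?addr0 // => j ji.
  by rewrite (negPf ji) mul0mx.
under eq_bigr do rewrite rowA.
rewrite (bigD1 i) //= eqxx trmx1 mulmx1 big1 ?addr0 // => j ji.
by rewrite (negPf ji) trmx0 mulmx0.
Qed.

Lemma mode_rows_proj (R : realType) n (i : 'I_n) :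
  (mode_rows R i)^T *m mode_rows R i = mode_proj R (pred1 i).
Proof.
rewrite tr_mxrow mul_mxcol_mxrow; apply/eq_mxblock => j k.
case: (eqVneq j k) => [<-|jk]; rewrite ?conform_mx_id /=.
  by case: (eqVneq j i) => _; rewrite ?trmx1 ?mul1mx ?mulmx0 ?raddf0.
case: (eqVneq j i) => [ji|_]; last by rewrite trmx0 mul0mx.
by rewrite -ji eq_sym (negPf jk) mulmx0.
Qed.

Lemma mode_rows_unit (R : realType) n (i : 'I_n) :
  mode_rows R i *m (mode_rows R i)^T = 1%:M.
Proof.
rewrite tr_mxrow mul_mxrow_mxcol (bigD1 i) //= eqxx trmx1 mulmx1.
by rewrite big1 ?addr0 // => j ji; rewrite (negPf ji) mul0mx.
Qed.

(* [Z = sigma U] is orthogonal and skew; testing the remaining modes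
   [A = E T D^(1/2)] against it, [<sigma A, A Z> <= ||A||^2], the symplectic
   relation for [T] turns the left-hand side into [tr (D U)], plus [2 c_i] since
   [U] is adapted to the rows [Y] of mode [i]. *)
Lemma largest_block_le (R : realType) n (T : modemx R n) (d c : 'I_n -> R) (i : 'I_n) (b : R) :
  symplectic T -> (forall k, 0 < d k <= b) ->
  (forall k, submxblock (T *m mode_diag d *m T^T) k k = (c k)%:M) ->
  c i + \sum_k d k <= 2 * b + \sum_(k | k != i) c k.
Proof.
move=> sT dk hc.
have d0 k : 0 < d k by case/andP: (dk k).
have db k : d k <= b by case/andP: (dk k).
set s := sigma R n; set j := sigma1 R; set Ji := mode_rows R i.
have st : s^T = - s by apply: sigma_tr.
have ss : s *m s = - 1%:M by apply: sigma_sqr.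
set D := mode_diag d; pose Q := mode_diag (fun k => Num.sqrt (d k)).
have QQ : Q *m Q = D.
  by rewrite mode_diag_mul; apply: eq_mxdiag => k; rewrite -expr2 sqr_sqrtr // ltW.
have Qt : Q^T = Q by apply: mode_diag_tr.
have Qs : Q *m s = s *m Q by apply: mode_diag_sigma.
have uQ : Q \in unitmx.
  case: (@mulmx1_unit _ _ Q (mode_diag (fun k => (Num.sqrt (d k))^-1))) => //.
  rewrite mode_diag_mul -mxdiagZ; apply: eq_mxdiag => k.
  by rewrite mulfV // gt_eqF // sqrtr_gt0.
set Y := Ji *m T *m Q.
have YY : Y *m Y^T = (c i)%:M.
  rewrite -hc -mode_rows_submxblock -/Ji -/D -QQ /Y !trmx_mul Qt.
  by rewrite !mulmxA.
(* Equality would pass from [Y] to [Ji *m T], since [Q] commutes with [s]; the symplectic relation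
   would then make the squared norm of [Ji *m T] equal to -2. *)
have neq : j *m Y *m s != Y.
  apply/eqP => e.
  have {e} e : j *m (Ji *m T) *m s = Ji *m T.
    apply: (can_inj (mulmxK uQ)); rewrite -/Y -[RHS]e /Y.
    by rewrite -!mulmxA Qs !mulmxA.
  have := mxtrace_mul_tr_ge0 (Ji *m T).
  rewrite -{1}e trmx_mul.
  have -> : j *m (Ji *m T) *m s *m (T^T *m Ji^T) = j *m (Ji *m (T *m s *m T^T)) *m Ji^T.
    by rewrite !mulmxA.
  rewrite sT mode_rows_sigma mulmxA sigma1_sqr mulNmx mul1mx mulNmx mode_rows_unit.
  by rewrite linearN /= mxtrace1; lra.
have [U [Ut UU Us YsU DU]] := complex_reflection st ss YY neq.
set E := mode_proj R (predC1 i).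
have EE : E *m E = E by apply: mode_proj_idem.
have Et : E^T = E by apply: mode_diag_tr.
have Es : E *m s = s *m E by apply: mode_diag_sigma.
have sJt : s *m Ji^T = Ji^T *m j.
  by apply: trmx_inj; rewrite !trmx_mul trmxK st sigma1_tr mulmxN mulNmx mode_rows_sigma.
(* The form on the remaining modes is the full one minus that of mode [i]; these two terms produce
   [\tr (D *m U)] and [2 * c i] below. *)
have EsE : E *m s *m E = s - Ji^T *m j *m Ji.
  by rewrite Es -mulmxA EE [E]mode_projC -mode_rows_proj mulmxBr mulmx1 mulmxA sJt.
set A := E *m T *m Q; set Z := s *m U.
have Zt : Z^T = - Z by rewrite trmx_mul Ut st mulmxN Us.
have ZZ : Z *m Z^T = 1%:M.
  by rewrite trmx_mul Ut st mulmxA -(mulmxA s) UU mulmx1 mulmxN ss opprK.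
have trA : \tr (A *m A^T) = 2 * \sum_(k | k != i) c k.
  rewrite -(mxtrace_modes (predC1 i) hc) -/E -/D -QQ /A !trmx_mul Qt Et.
  by rewrite !mulmxA [LHS]mxtrace_mulC !mulmxA EE.
have AE : A = E *m T *m Q by [].
have ZE : Z = s *m U by [].
clearbody A Z.
(* Since [s] and [Z] are orthogonal, both arguments have the squared norm of [A]. *)
have := mxtrace_amgm (s *m A) (A *m Z).
have -> : \tr (s *m A *m (s *m A)^T) = \tr (A *m A^T).
  rewrite trmx_mul st mxtrace_mulC mulmxN mulNmx !mulmxA.
  by rewrite -(mulmxA A^T s) ss mulmxN mulmx1 mulNmx opprK mxtrace_mulC.
have -> : \tr (A *m Z *m (A *m Z)^T) = \tr (A *m A^T).
  by rewrite trmx_mul mulmxA -(mulmxA A Z) ZZ mulmx1.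
rewrite trA.
have -> : \tr (s *m A *m (A *m Z)^T) = \tr (D *m U) + 2 * c i.
  rewrite trmx_mul Zt mulNmx mulmxN linearN /=.
  have -> : \tr (s *m A *m (Z *m A^T)) = \tr (E *m s *m E *m (T *m Q *m Z *m Q *m T^T)).
    by rewrite AE !trmx_mul Et Qt !mulmxA [LHS]mxtrace_mulC !mulmxA.
  rewrite EsE mulmxBl linearB /= opprB addrC.
  congr (_ + _).
    have -> : \tr (s *m (T *m Q *m Z *m Q *m T^T)) = \tr (T^T *m s *m T *m (Q *m Z *m Q)).
      by rewrite !mulmxA [LHS]mxtrace_mulC !mulmxA.
    rewrite symplectic_tr // ZE.
    have -> : s *m (Q *m (s *m U) *m Q) = - (Q *m U *m Q).
      by rewrite !mulmxA -Qs -(mulmxA Q s s) ss mulmxN mulmx1 !mulNmx.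
    by rewrite linearN /= opprK mxtrace_mulC mulmxA QQ.
  have -> : \tr (Ji^T *m j *m Ji *m (T *m Q *m Z *m Q *m T^T)) = \tr (j *m (Y *m s *m U *m Y^T)).
    rewrite -!mulmxA mxtrace_mulC /Y !trmx_mul Qt ZE.
    by rewrite !mulmxA.
  rewrite YsU mulNmx -mulmxA YY mulmxN mulmxA sigma1_sqr mulNmx mul1mx opprK.
  by rewrite mxtrace_scalar mulr_natl.
have := DU D b.
have -> : \tr D = 2 * \sum_k d k.
  rewrite mxtrace_mxdiag big_distrr /=; apply: eq_bigr => k _.
  by rewrite mxtrace_scalar mulr_natl.
move=> h; have {h} := h _; move=> h.
(* The matrix [b%:M - D] is positive semidefinite, being the square of the symmetric [F]. *)
have : forall X : 'M_(2, _), \tr (X *m D *m X^T) <= b * \tr (X *m X^T).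
  move=> X; pose F := mode_diag (fun k => Num.sqrt (b - d k)).
  have FF : F *m F = b%:M - D.
    rewrite -mxdiagZ -mxdiagB mode_diag_mul; apply: eq_mxdiag => k.
    by rewrite -expr2 sqr_sqrtr ?subr_ge0 // raddfB.
  have Ft : F^T = F by apply: mode_diag_tr.
  have := mxtrace_mul_tr_ge0 (X *m F).
  rewrite trmx_mul Ft mulmxA -(mulmxA X F F) FF mulmxBr mulmxBl linearB /=.
  by rewrite mul_mx_scalar -scalemxAl mxtraceZ subr_ge0.
move/h; rewrite mulr2n; lra.
Qed.

Lemma sum_take (R : realType) (n : nat) (f : 'I_n.+1 -> R) (k : nat) :
  \sum_(x <- take k.+1 [seq f j | j : 'I_n.+1]) x =
  \sum_(j < n.+1 | (j <= k)%N) f j.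
Proof.
set s := [seq f j | j : 'I_n.+1].
have ss : size s = n.+1 by rewrite size_map size_enum_ord.
rewrite (big_nth 0) size_take_min ss big_mkord.
rewrite (big_ord_widen n.+1 (fun i => (take k.+1 s)`_i)) ?geq_minr //.
apply: eq_big => j; first by rewrite leq_min ltn_ord andbT.
rewrite leq_min => /andP[jk _].
by rewrite nth_take // nth_image_ord.
Qed.

Theorem theorem1 (R : realType) (n : nat) (d c : 'I_n.+1 -> R)
    (d_gt0 : forall k, 0 < d k) (c_gt0 : forall k, 0 < c k)
    (d_nondecr : forall i j : 'I_n.+1, (i <= j)%N -> d i <= d j)
    (c_nondecr : forall i j : 'I_n.+1, (i <= j)%N -> c i <= c j) :
  (exists gamma : modemx R n.+1,
     [/\ strictly_positive gamma,
         symplectic_eigenvalues gamma d &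
         symplectic_main_diagonal gamma c])
  <->
  (forall k : 'I_n.+1,
     \sum_(j < n.+1 | (j <= k)%N) c j >= \sum_(j < n.+1 | (j <= k)%N) d j) /\
  c ord_max - \sum_(j < n.+1 | (j < n)%N) c j
    <= d ord_max - \sum_(j < n.+1 | (j < n)%N) d j.
Proof.
have ltE (f : 'I_n.+1 -> R) : \sum_j f j = f ord_max + \sum_(j < n.+1 | (j < n)%N) f j.
  rewrite (bigD1 ord_max) //=; congr (_ + _); apply: eq_bigl => j.
  by rewrite ltn_neqAle -ltnS ltn_ord andbT.
split=> [[gamma [_ hd hc]]|[hs hl]].
  have [T sT Tc] := local_normal_form hd hc; split=> [k|].
    apply: (sum_smallest_le _ sT _ _ Tc) => // j; exact: ltW.
  have := @largest_block_le _ _ T d c ord_max (d ord_max) sT _ Tc.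
  have -> : \sum_(k | k != ord_max) c k = \sum_(j < n.+1 | (j < n)%N) c j.
    by apply: (addrI (c ord_max)); rewrite -ltE [RHS](bigD1 ord_max).
  rewrite ltE => h; suff : c ord_max + (d ord_max + \sum_(j < n.+1 | (j < n)%N) d j) <=
    2 * d ord_max + \sum_(j < n.+1 | (j < n)%N) c j by lra.
  by apply: h => k; rewrite d_gt0 d_nondecr // -ltnS.
apply: gamma_of_realizable => //.
have mono (f : 'I_n.+1 -> R) : (forall i j : 'I_n.+1, (i <= j)%N -> f i <= f j) ->
    pairwise <=%R [seq f j | j : 'I_n.+1].
  move=> fmono; apply/(pairwiseP 0) => i j; rewrite !inE size_map size_enum_ord => hi hj ij.
  by rewrite (nth_image_ord f (Ordinal hi)) (nth_image_ord f (Ordinal hj)) fmono // ltnW.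
have lastE (f : 'I_n.+1 -> R) : last 0 [seq f j | j : 'I_n.+1] = f ord_max.
  by rewrite -nth_last size_map size_enum_ord (nth_image_ord f ord_max).
apply: (@realizable_of_sums _ n); rewrite ?size_image ?card_ord //.
- exact: mono.
- exact: mono.
- by apply/allP => _ /mapP[k _ ->].
- by apply/allP => _ /mapP[k _ ->].
(* A prefix of length [k.+1] holds the indices up to [k]; once [k] exceeds [n] it is the whole list,
   covered by the condition at [ord_max]. *)
- case=> [|k]; first by rewrite !take0 !big_nil.
  rewrite !sum_take; have [kn|nk] := ltnP k n.+1; first exact: (hs (Ordinal kn)).
  have all_le (f : 'I_n.+1 -> R) : \sum_(j < n.+1 | (j <= k)%N) f j =
      \sum_(j < n.+1 | (j <= @ord_max n)%N) f j.
    by apply: eq_bigl => j; rewrite leq_ord (leq_trans (leq_ord j) (ltnW nk)).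
  by rewrite !all_le.
(* Twice the last entry minus the total is the last entry minus the sum of the others. *)
rewrite !lastE !big_image /= !ltE; lra.
Qed.
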